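(* Let $\phi$ be a $\mathbf G_1(\mathbf F_q,\mathbf G_1)$-formula. Then there exist a finite index set $I\subset\mathbb N$ and finite sets $A,B,C_i\subseteq\mathcal L$ ($i\in I$) such that $$\mathbf G_{=1}\phi\ \equiv_{\mathit{fin}}\ \mathbf G_{=1}\Big(\bigwedge_{l\in A}l\ \wedge\ \mathbf F_{=1}\mathbf G_{=1}\Big(\bigwedge_{l\in B}l\Big)\ \wedge\ \bigwedge_{i\in I}\mathbf F_{=1}\Big(\bigwedge_{l\in C_i}l\Big)\Big).$$
   Context: Fix a finite set $\mathcal A$ of atomic propositions; $\mathcal L:=\mathcal A\cup\{\neg a\mid a\in\mathcal A\}$ is the set of literals. A Markov chain is $M=(S,P,s_0,L)$ with $S$ countable, $P:S\times S\to[0,1]$, $\sum_tP(s,t)=1$ for all $s$, initial state $s_0$, labeling $L:S\to2^{\mathcal A}$. $\mathbb P_{M(s)}$ is the standard probability measure on runs from $s$; $\pi[i]$ is the $i$-th state of run $\pi$. PCTL$(\mathbf F,\mathbf G)$ formulae: $a,\neg a$ ($a\in\mathcal A$), $\wedge,\vee$, $\mathbf F_{\rhd q}\varphi$, $\mathbf G_{\rhd q}\varphi$ ($\rhd\in\{\ge,>\}$, $q\in[0,1]\cap\mathbb Q$), with $M,s\models\mathbf F_{\rhd q}\varphi$ iff $\mathbb P_{M(s)}(\{\pi\mid\exists i: M,\pi[i]\models\varphi\})\rhd q$ and $M,s\models\mathbf G_{\rhd q}\varphi$ iff $\mathbb P_{M(s)}(\{\pi\mid\forall i:M,\pi[i]\models\varphi\})\rhd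 q$; literals via $L$, Boolean connectives as usual. $=1$ means $\ge1$; an empty conjunction is true. $M$ is a model of $\phi$ if $M,s_0\models\phi$. Two formulae are finitely equivalent, $\phi\equiv_{\mathit{fin}}\psi$, if they have the same finite models (Markov chains with finite $S$). A $\mathbf G_1(\mathbf F_q,\mathbf G_1)$-formula is $\mathbf G_{=1}\Psi$ with $\Psi::=a\mid\neg a\mid\Psi\wedge\Psi\mid\mathbf F_{\rhd q}\Psi\mid\mathbf G_{=1}\Psi$. *)

(* Defs.v *)
From HB Require Import structures.
From mathcomp Require Import all_boot all_order all_algebra.
From mathcomp Require Import finmap.
From mathcomp Require Import all_classical all_reals all_analysis.
From mathcomp Require Import lra.

Set Implicit Arguments.
Unset Strict Implicit.
Unset Printing Implicit Defensive.

Import Order.TTheory GRing.Theory Num.Theory.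
Import numFieldNormedType.Exports.

Local Open Scope classical_set_scope.
Local Open Scope ring_scope.

Record markov_chain (R : realType) (AP : finType) := MarkovChain {
  state : countType;
  trans : state -> state -> R;
  init : state;
  label : state -> {set AP};
  trans_itv : forall s t, 0 <= trans s t <= 1;
  trans_sum1 : forall s, (\esum_(t in [set: state]) (trans s t)%:E = 1)%E
}.

Section Runs.
Context {R : realType} {AP : finType} (M : markov_chain R AP).

Definition run : Type := nat -> state M.

HB.instance Definition _ := Choice.on run.
HB.instance Definition _ := isPointed.Build run (fun=> init M).

Definition cylinder (w : seq (state M)) : set run :=
  [set pi | mkseq pi (size w) = w].

Definition cylinders : set (set run) := range cylinder.

Definition run_space := g_sigma_algebraType cylinders.

HB.instance Definition _ := Measurable.on run_space.

Fixpoint path_prob (s : state M) (w : seq (state M)) : R :=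
  if w is t :: w' then trans s t * path_prob t w' else 1.

Definition is_run_measure (s : state M) (mu : probability run_space R) :=
  forall w, mu (cylinder (s :: w)) = (path_prob s w)%:E.

Lemma measurable_cylinder w : measurable (cylinder w : set run_space).
Proof. by apply: sub_sigma_algebra; exists w. Qed.

Lemma trans_ge0 (s t : state M) : 0 <= trans s t.
Proof. by case/andP: (trans_itv s t). Qed.

Lemma path_prob_ge0 s w : 0 <= path_prob s w.
Proof.
by elim: w s => [|t w IH] s //=; rewrite mulr_ge0 ?trans_ge0.
Qed.

(* Existence of the run measure: the image of the uniform distribution on    *)
(* [0, 1] under a coding of runs.  The interval [0, 1[ is cut into           *)
(* consecutive intervals of length [trans s t], one for each t; a real u in  *)
(* the interval of t selects the transition s -> t, and the relative         *)
(* position of u in that interval encodes the rest of the run.               *)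
Let weight (s : state M) (n : nat) : R :=
  if pickle_inv n is Some t then trans s t else 0.

Let cumul (s : state M) (n : nat) : R := \sum_(k < n) weight s k.

Let weight_ge0 s n : 0 <= weight s n.
Proof. by rewrite /weight; case: pickle_inv => // t; exact: trans_ge0. Qed.

Let cumul_mono s m n : (m <= n)%N -> cumul s m <= cumul s n.
Proof.
move=> mn; rewrite /cumul -!(big_mkord predT (weight s)).
rewrite (big_cat_nat (leq0n _) mn) /= lerDl.
by apply: sumr_ge0 => i _; exact: weight_ge0.
Qed.

Let weight_series s : (\sum_(0 <= k <oo) (weight s k)%:E = 1)%E.
Proof.
rewrite nneseries_esumT; last by move=> n; rewrite lee_fin weight_ge0.
rewrite -(trans_sum1 s).
transitivity (\esum_(n in choice.pickle @` [set: state M]) (weight s n)%:E)%E.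
  rewrite [RHS]esum_mkcond; apply: eq_esum => n _.
  case: ifPn => //; rewrite notin_setE /weight => nP.
  case E : (pickle_inv n) => [t|//]; exfalso; apply: nP; exists t => //.
  by have := @pickle_invK (state M) n; rewrite E.
rewrite esum_image; last by move=> x y _ _; exact: (pcan_inj pickleK_inv).
by apply: eq_esum => t _; rewrite /weight pickleK_inv.
Qed.

Let cumul_le1 s n : cumul s n <= 1.
Proof.
rewrite -lee_fin -(weight_series s) /cumul -sumEFin.
rewrite -(big_mkord predT (fun k => (weight s k)%:E)).
by apply: nneseries_lim_ge => k _ _; rewrite lee_fin.
Qed.

Let cumul_gt s u : u < 1 -> exists n, u < cumul s n.
Proof.
move=> u1; apply: contrapT => /forallNP H.
suff: (1 <= u%:E)%E by rewrite lee_fin leNgt u1.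
rewrite -(weight_series s); apply: lime_le.
  by apply: is_cvg_nneseries => k _ _; rewrite lee_fin.
apply: nearW => n; rewrite big_mkord sumEFin lee_fin leNgt.
exact/negP/H.
Qed.

Let low (s t : state M) : R := cumul s (choice.pickle t).

Let lowD s t : low s t + trans s t = cumul s (choice.pickle t).+1.
Proof. by rewrite /cumul big_ord_recr /= /weight pickleK_inv. Qed.

Let sel (s : state M) (u : R) (t : state M) :=
  low s t <= u < low s t + trans s t.

Let sel_ex s u : 0 <= u < 1 -> exists t, sel s u t.
Proof.
case/andP=> u0 /(cumul_gt s) ex.
case: (ex_minnP ex) => -[|m]; first by rewrite /cumul big_ord0 ltNge u0.
move=> um min.
have mu : cumul s m <= u by rewrite leNgt; apply/negP => /min; rewrite ltnn.
have := le_lt_trans mu um; rewrite /cumul big_ord_recr /= ltrDl.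
rewrite /weight; case E : (pickle_inv m) => [t|]; last by rewrite ltxx.
have mE : choice.pickle t = m by have := @pickle_invK (state M) m; rewrite E.
by move=> _; exists t; rewrite /sel lowD /low mE mu.
Qed.

Let sel_uniq s u t t' : sel s u t -> sel s u t' -> t = t'.
Proof.
rewrite /sel !lowD /low => /andP[a b] /andP[a' b'].
apply: (pcan_inj pickleK_inv); apply/eqP; rewrite eqn_leq.
apply/andP; split; rewrite leqNgt; apply/negP => /(cumul_mono s) h.
  by have := lt_le_trans b' (le_trans h a); rewrite ltxx.
by have := lt_le_trans b (le_trans h a'); rewrite ltxx.
Qed.

Let next s u := xget s [set t | sel s u t].

Let nextP s u t : 0 <= u < 1 -> next s u = t <-> sel s u t.
Proof.
move=> /(sel_ex s)[t' st'].
have h : sel s u (next s u).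
  by apply: (@xgetPex _ s [set t | sel s u t]); exists t'.
by split=> [<-//|]; exact: sel_uniq.
Qed.

Let step (x : state M * R) : state M * R :=
  let t := next x.1 x.2 in (t, (x.2 - low x.1 t) / trans x.1 t).

Let code s u : run := fun n => (iter n step (s, u)).1.

Fixpoint code_start (s : state M) (w : seq (state M)) : R :=
  if w is t :: w' then low s t + trans s t * code_start t w' else 0.

Let code_start_itv s w : 0 <= code_start s w /\ code_start s w + path_prob s w <= 1.
Proof.
elim: w s => [|t w IH] s /=; first by rewrite add0r.
have [a b] := IH t; have P0 := trans_ge0 s t.
split.
  by rewrite addr_ge0 ?mulr_ge0// /low /cumul sumr_ge0// => i _; exact: weight_ge0.
rewrite -addrA -mulrDr (le_trans _ (cumul_le1 s (choice.pickle t).+1))//.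
rewrite -lowD lerD2l.
by rewrite -[leRHS]mulr1 ler_wpM2l.
Qed.

Let code0 s u : code s u 0%N = s. Proof. by []. Qed.

Let codeS s u n :
  code s u n.+1 = code (next s u) ((u - low s (next s u)) / trans s (next s u)) n.
Proof. by rewrite /code iterSr. Qed.

Let code_cylinder s u w : 0 <= u < 1 ->
  cylinder (s :: w) (code s u) <-> code_start s w <= u < code_start s w + path_prob s w.
Proof.
elim: w s u => [|t w IH] s u u01.
  by rewrite /cylinder /= add0r.
set u' := (u - low s (next s u)) / trans s (next s u).
have cE : cylinder (s :: t :: w) (code s u) <->
    next s u = t /\ cylinder (t :: w) (code (next s u) u').
  rewrite /cylinder /= /mkseq /=.
  have tl m n : [seq code s u i | i <- iota m.+1 n] =
                [seq code (next s u) u' i | i <- iota m n].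
    by rewrite (iotaDl 1 m n) -map_comp; apply: eq_map => i; exact: codeS.
  rewrite !tl; split.
    move=> e; have e1 : next s u = t by exact: (congr1 (fun x => nth s x 1) e).
    split; first by [].
    move: (congr1 (drop 2) e) => /=; rewrite !drop0 => e2.
    exact: (congr2 cons e1 e2).
  move=> [e1 e]; move: (congr1 (drop 1) e) => /=; rewrite !drop0 => e2.
  exact: (congr2 cons erefl (congr2 cons e1 e2)).
have [lo hi] := code_start_itv t w.
have P0 := trans_ge0 s t.
split.
- case/cE => nE; rewrite /u' nE.
  have /andP[a b] : sel s u t by apply/nextP.
  have P1 : 0 < trans s t by rewrite -(ltrDl (low s t)) (le_lt_trans a).
  have v01 : 0 <= (u - low s t) / trans s t < 1.
    by rewrite divr_ge0 ?subr_ge0//= ltr_pdivrMr// mul1r ltrBlDl.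
  move/(IH _ _ v01); rewrite ler_pdivlMr// ltr_pdivrMr// => /andP[h1 h2].
  apply/andP; split => /=; lra.
- move=> /= /andP[h1 h2].
  have sl : sel s u t.
    rewrite /sel; have m1 : 0 <= trans s t * code_start t w by rewrite mulr_ge0.
    have m2 : trans s t * (code_start t w + path_prob t w) <= trans s t.
      by rewrite -[leRHS]mulr1 ler_wpM2l.
    by apply/andP; split; lra.
  have P1 : 0 < trans s t.
    by case/andP: sl => a b; rewrite -(ltrDl (low s t)) (le_lt_trans a).
  have nE : next s u = t by apply/nextP.
  apply/cE; split => //; rewrite /u' nE.
  have /andP[a b] := sl.
  have v01 : 0 <= (u - low s t) / trans s t < 1.
    by rewrite divr_ge0 ?subr_ge0//= ltr_pdivrMr// mul1r ltrBlDl.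
  apply/(IH _ _ v01); rewrite ler_pdivlMr// ltr_pdivrMr//.
  by apply/andP; split; lra.
Qed.

Let coding s (u : measurableTypeR R) : run_space :=
  code s (if 0 <= u < 1 then u else 0).

Let u01 (u : R) : 0 <= (if 0 <= u < 1 then u else 0) < 1.
Proof. by case: ifP => //; rewrite lexx ltr01. Qed.

Let coding_preimage s w :
  coding s @^-1` (cylinder (s :: w)) `&` `[0, 1[ =
  [set` `[code_start s w, code_start s w + path_prob s w[].
Proof.
have [lo hi] := code_start_itv s w.
apply/seteqP; split => u /=.
  move=> [+]; rewrite !in_itv /= => + h.
  by move/(code_cylinder _ _ (u01 u)); rewrite h.
rewrite !in_itv /= => h; have h' : 0 <= u < 1.
  by case/andP: h => h1 h2; rewrite (le_trans lo)//= (lt_le_trans h2).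
by split => //; apply/(code_cylinder _ _ (u01 u)); rewrite h'.
Qed.

Let cylinder_neq s t w : t != s -> forall u, ~ cylinder (t :: w) (coding s u).
Proof. by move=> /eqP ts u; rewrite /cylinder /= => -[/esym]. Qed.

Let measurable_coding s : measurable_fun setT (coding s).
Proof.
apply: (@measurability _ _ _ _ setT (coding s)
  (cylinders : set (set run_space))) => // _ [_ [w _ <-] <-].
rewrite setTI.
case: w => [|t w].
  by rewrite (_ : cylinder [::] = setT) ?preimage_setT//; apply/seteqP; split.
have [->|ts] := eqVneq t s; last first.
  rewrite (_ : _ @^-1` _ = set0) //; apply/seteqP; split => // u.
  exact: cylinder_neq.
rewrite -(setIT (_ @^-1` _)) -(setUv `[(0:R), 1[%classic) setIUr.
apply: measurableU; first by rewrite coding_preimage.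
have [c0|c0] := pselect (cylinder (s :: w) (code s 0)).
  rewrite setIidr; first exact: measurableC.
  move=> u /=; rewrite in_itv /= => /negP/negbTE h.
  by rewrite /coding h.
rewrite (_ : _ `&` _ = set0) //; apply/seteqP; split => // u /= [].
by rewrite in_itv /= => + /negP/negbTE h; rewrite /coding h.
Qed.

Let uniform_itv (a b : R) : 0 <= a -> a <= b -> b <= 1 ->
  (uniform_prob (@ltr01 R) `[a, b[ = (b - a)%:E)%E.
Proof.
move=> a0 ab b1; rewrite /uniform_prob.
rewrite (eq_integral (fun=> 1%E)); last first.
  move=> x; rewrite inE /= in_itv /= => /andP[ax xb].
  by rewrite /uniform_pdf (le_trans a0 ax) (ltW (lt_le_trans xb b1)) subr0 invr1.
rewrite integral_cst//= mul1e lebesgue_measure_itv /= lte_fin.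
move: ab; rewrite le_eqVlt => /predU1P[->|ab]; first by rewrite ltxx subrr.
by rewrite ab EFinB.
Qed.

Lemma run_measure_exists s : exists mu, is_run_measure s mu.
Proof.
pose P : probability (measurableTypeR R) R := uniform_prob (@ltr01 R).
pose X : {mfun measurableTypeR R >-> run_space} :=
  mfun_Sub (mem_set (measurable_coding s)).
exists (distribution P X) => w.
rewrite /distribution /pushforward /=.
pose A : set (measurableTypeR R) := coding s @^-1` cylinder (s :: w).
pose I : set (measurableTypeR R) := `[(0:R), 1[%classic.
have mA : measurable A.
  rewrite -[A]setTI; apply: measurable_coding => //.
  exact: measurable_cylinder.
have mI : measurable I by exact: measurable_itv.
have mCI : measurable (~` I) by exact: measurableC.
transitivity (P (A `&` I) + P (A `&` ~` I))%E.
  rewrite -measureU.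
  - by rewrite -setIUr setUv setIT.
  - exact: measurableI.
  - exact: measurableI.
  - by rewrite setIACA setICr setI0.
have -> : (P (A `&` ~` I) = 0)%E.
  apply/eqP; rewrite -measure_le0.
  apply: (@le_trans _ _ (P (~` I))).
    by apply: le_measure; rewrite ?inE//; exact: measurableI.
  by rewrite probability_setC// [P _]uniform_itv// subr0 subee.
have [lo hi] := code_start_itv s w.
rewrite adde0 coding_preimage [LHS]uniform_itv//; last first.
  by rewrite lerDl path_prob_ge0.
by rewrite addrC addKr.
Qed.

Lemma run_measure_unique s (mu nu : probability run_space R) :
  is_run_measure s mu -> is_run_measure s nu ->
  forall A, measurable A -> mu A = nu A.
Proof.
move=> hmu hnu.
have take_mk (pi : run) m n : (m <= n)%N -> take m (mkseq pi n) = mkseq pi m.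
  by move=> mn; rewrite /mkseq -map_take take_iota (minn_idPl mn).
have cyl_nil : cylinder [::] = setT by apply/seteqP; split.
pose G := cylinders `|` [set set0].
have GE : @measurable _ run_space = <<s G >>.
  apply/seteqP; split; apply: smallest_sub.
  - exact: smallest_sigma_algebra.
  - by move=> A cA; apply: sub_sigma_algebra; left.
  - exact: smallest_sigma_algebra.
  - by move=> A [cA|->]; [exact: sub_sigma_algebra|exact: measurable0].
have cyl_other (m : probability run_space R) t w : is_run_measure s m ->
    t != s -> m (cylinder (t :: w)) = 0%E.
  move=> hm ts; apply/eqP; rewrite -measure_le0.
  have m1 : m (cylinder [:: s]) = 1%E by rewrite hm.
  apply: (@le_trans _ _ (m (~` cylinder [:: s]))).
    apply: le_measure; rewrite ?inE.
    - exact: measurable_cylinder.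
    - by apply: measurableC; exact: measurable_cylinder.
    - by move=> pi [e _] [e']; move: ts; rewrite -e -e' eqxx.
  rewrite probability_setC; last exact: measurable_cylinder.
  by rewrite m1 subee.
move=> A mA.
apply: (@measure_unique _ R run_space G (fun=> setT) GE _ _ _ mu nu _ _ A mA).
- move=> {mA}A B [[v _ <-]|->]; last by rewrite set0I; right.
  move=> [[w _ <-]|->]; last by rewrite setI0; right.
  have H : forall v w, (size v <= size w)%N -> G (cylinder v `&` cylinder w).
    move=> {}v {}w vw; have [e|ne] := eqVneq (take (size v) w) v.
      left; exists w => //; apply/seteqP; split => pi /=.
        move=> pw; split => //; rewrite /cylinder /= -[RHS]e -pw.
        by rewrite take_mk// size_mkseq.
      by case.
    right; apply/seteqP; split => // pi [/= pv pw].
    by move: ne; rewrite -[X in take _ X]pw take_mk// pv eqxx.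
  by case: (leqP (size v) (size w)) => [|/ltnW] /H //; rewrite setIC.
- by move=> _; left; exists [::].
- by rewrite bigcup_const.
- move=> {mA}A [[[|t w] _ <-]|->]; rewrite ?measure0//.
    by rewrite cyl_nil [LHS]probability_setT [RHS]probability_setT.
  have [->|ts] := eqVneq t s; first exact: etrans (hmu w) (esym (hnu w)).
  by apply: (etrans (cyl_other mu t w hmu ts)); rewrite -(cyl_other nu t w hnu ts).
- by move=> _; rewrite -ge0_fin_numE ?fin_num_measure.
Qed.

Definition run_measure (s : state M) : probability run_space R :=
  sval (cid (run_measure_exists s)).

Lemma run_measureP s : is_run_measure s (run_measure s).
Proof. exact: svalP (cid (run_measure_exists s)). Qed.

End Runs.

Section Syntax.
Context (AP : finType).

(* The pair (a, true) is the literal a and (a, false) is its negation. *)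
Definition literal := (AP * bool)%type.

HB.instance Definition _ := Finite.on literal.

Variant bound := Geq | Gt.

Definition threshold := {q : rat | 0 <= q <= 1}.

Lemma threshold1_proof : 0 <= (1 : rat) <= 1.
Proof. by rewrite ler01 lexx. Qed.

Definition threshold1 : threshold := exist _ 1 threshold1_proof.

(* [FTrue] stands for the empty conjunction. *)
Inductive formula :=
| FTrue
| FLit of literal
| FAnd of formula & formula
| FOr of formula & formula
| FEv of bound & threshold & formula
| FAlw of bound & threshold & formula.

Definition F1 : formula -> formula := FEv Geq threshold1.
Definition G1 : formula -> formula := FAlw Geq threshold1.

(* [FTrue] is deliberately not in the grammar of bodies. *)
Inductive G1FqG1_body : formula -> Prop :=
| Body_lit l : G1FqG1_body (FLit l)
| Body_and f g : G1FqG1_body f -> G1FqG1_body g -> G1FqG1_body (FAnd f g)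
| Body_F b q f : G1FqG1_body f -> G1FqG1_body (FEv b q f)
| Body_G f : G1FqG1_body f -> G1FqG1_body (G1 f).

Definition G1FqG1_formula (phi : formula) : Prop :=
  exists2 psi, G1FqG1_body psi & phi = G1 psi.

Definition conj_lits (A : {set literal}) : formula :=
  \big[FAnd/FTrue]_(l in A) FLit l.

End Syntax.

Arguments FTrue {AP}.

Definition meets {R : realType} (b : bound) (x : \bar R) (q : threshold) : Prop :=
  match b with
  | Geq => ((ratr (val q))%:E <= x)%E
  | Gt => ((ratr (val q))%:E < x)%E
  end.

Fixpoint sat {R : realType} {AP : finType} (M : markov_chain R AP)
    (s : state M) (phi : formula AP) : Prop :=
  match phi with
  | FTrue => True
  | FLit l => (l.1 \in label s) = l.2
  | FAnd f g => sat s f /\ sat s g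
  | FOr f g => sat s f \/ sat s g
  | FEv b q f =>
      meets b (run_measure s [set pi | exists i, sat (pi i) f]) q
  | FAlw b q f =>
      meets b (run_measure s [set pi | forall i, sat (pi i) f]) q
  end.

Lemma measurable_run_state {R : realType} {AP : finType} (M : markov_chain R AP)
    (i : nat) (A : set (state M)) :
  measurable ([set pi | A (pi i)] : set (run_space M)).
Proof.
pose C n : set (run_space M) :=
  if @choice.unpickle (seq (state M)) n is Some w then
    if `[< size w = i.+1 /\ A (last (init M) w) >] then cylinder w else set0
  else set0.
rewrite (_ : [set pi | _] = \bigcup_n C n); last first.
  apply/seteqP; split => pi /=.
    move=> Api; exists (choice.pickle (mkseq pi i.+1)) => //.
    rewrite /C choice.pickleK asboolT; first exact: (congr1 (mkseq pi) (size_mkseq pi i.+1)).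
    by split; [rewrite size_mkseq|rewrite mkseqS last_rcons].
  case=> n _; rewrite /C; case: choice.unpickle => // w; case: asboolP => // -[sw Aw].
  by rewrite /cylinder /= sw mkseqS => we; move: Aw; rewrite -we last_rcons.
apply: bigcupT_measurable => n; rewrite /C; case: choice.unpickle => // w.
by case: asboolP => // _; exact: measurable_cylinder.
Qed.

Lemma measurable_exists_sat {R : realType} {AP : finType}
    (M : markov_chain R AP) (phi : formula AP) :
  measurable ([set pi | exists i, sat (pi i) phi] : set (run_space M)).
Proof.
rewrite (_ : [set pi | _] = \bigcup_i [set pi : run_space M | sat (pi i) phi]).
  by apply: bigcupT_measurable => i; exact: (measurable_run_state i [set s | sat s phi]).
by apply/seteqP; split => pi [i]; [exists i|move=> _; exists i].
Qed.

Lemma measurable_forall_sat {R : realType} {AP : finType}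
    (M : markov_chain R AP) (phi : formula AP) :
  measurable ([set pi | forall i, sat (pi i) phi] : set (run_space M)).
Proof.
rewrite (_ : [set pi | _] = \bigcap_i [set pi : run_space M | sat (pi i) phi]).
  apply: bigcapT_measurable => i.
  exact: (measurable_run_state i [set s | sat s phi]).
by apply/seteqP; split => pi h i => [_|]; exact: h.
Qed.

Definition models {R : realType} {AP : finType} (M : markov_chain R AP)
  (phi : formula AP) : Prop := sat (init M) phi.

Definition fin_equiv (R : realType) {AP : finType} (phi psi : formula AP) : Prop :=
  forall M : markov_chain R AP, finite_set [set: state M] ->
    (models M phi <-> models M psi).

(* Main.v *)
Require Import Defs.
From mathcomp Require Import all_boot all_order all_algebra.
From mathcomp Require Import finmap.
From mathcomp Require Import all_classical all_reals all_analysis.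

Set Implicit Arguments.
Unset Strict Implicit.
Unset Printing Implicit Defensive.

Import Order.TTheory GRing.Theory Num.Theory.
Import numFieldNormedType.Exports.

(** In a finite chain almost every run ends up in a bottom strongly connected
component and visits each of its states.  Hence, at a state of such a
component, [F_q f] with a satisfiable and nontrivial bound says that [f] holds
somewhere in the component, and [G_1 f] that it holds everywhere in it: by
induction a body is equivalent there to literals of the current state,
literals that hold throughout the component, and conjunctions of literals
each of which occurs in it.  Outside the bottom components only the literals
that occur under no [F_q] matter.

Almost sure reachability is proved by a geometric bound: if every state
reachable from [s] can reach [X], there are [N] and [c < 1] such that [X] is
avoided for [N] steps with probability at most [c] from each of these states,
hence for [k * N] steps with probability at most [c ^+ k]. *)

(** * Reachability and bottom components *)

Section Reachability.
Local Open Scope classical_set_scope.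
Local Open Scope ring_scope.
Context {R : realType} {AP : finType} (M : markov_chain R AP).
Implicit Types (s t u : state M) (w : seq (state M)) (X : set (state M)).

Definition reach s t := exists2 w, 0 < path_prob s w & last s w = t.

(** These are the states of bottom strongly connected components: nothing reachable from [s] loses
    the way back, so the states reachable from [s] form its component. *)
Definition bottom s := forall t, reach s t -> reach t s.

Lemma path_prob_cat s w w' :
  path_prob s (w ++ w') = path_prob s w * path_prob (last s w) w'.
Proof. by elim: w s => [|t w IH] s /=; rewrite ?mul1r// IH mulrA. Qed.

Lemma reach_refl s : reach s s.
Proof. by exists [::]; rewrite /= ?ltr01. Qed.

Lemma reach_trans s t u : reach s t -> reach t u -> reach s u.
Proof.
move=> [w w0 <-] [w' w'0 <-]; exists (w ++ w'); last by rewrite last_cat.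
by rewrite path_prob_cat mulr_gt0.
Qed.

Lemma reach_step s t : 0 < trans s t -> reach s t.
Proof. by move=> h; exists [:: t] => //=; rewrite mulr1. Qed.

Lemma reach_bottom s t : bottom s -> reach s t -> bottom t.
Proof.
by move=> bs st u tu; apply: reach_trans (bs _ (reach_trans st tu)) st.
Qed.

(** A state [s] that is not bottom reaches some [t] with no way back. The states reachable from [t]
    are among those reachable from [s] but leave out [s], so their number drops, and induction on it
    ends at a bottom state. *)
Lemma bottom_exists s : finite_set [set: state M] ->
  exists2 t, reach s t & bottom t.
Proof.
move=> /finite_seqP[r rE].
have rT t : t \in r by have : [set: state M] t by []; rewrite rE.
pose N t := count (fun u => `[< reach t u >]) r.
move: {2}(N s) (leqnn (N s)) => n; elim: n s => [|n IH] s Ns.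
  exists s; [exact: reach_refl|move=> t _; exfalso].
  move: Ns; rewrite leqNgt -has_count => /negP; apply; apply/hasP.
  by exists s; [exact: rT|apply/asboolP; exact: reach_refl].
have [bs|] := pselect (bottom s); first by exists s => //; exact: reach_refl.
move=> /existsNP[t /not_implyP[st nts]].
have Nlt : (N t < N s)%N.
  rewrite /N; set p := fun u => `[< reach t u >].
  set q := fun u => `[< reach s u >].
  have -> : count q r = (count p r + count (predD q p) r)%N.
    rewrite -(count_predUI p (predD q p)).
    rewrite (@eq_count _ (predI _ _) pred0) ?count_pred0 ?addn0; last first.
      by move=> u /=; case: (p u).
    apply: eq_count => u /=; case pu: (p u) => //=.
    by apply/asboolP/(reach_trans st)/asboolP.
  rewrite -[ltnLHS]addn0 ltn_add2l -has_count; apply/hasP; exists s => //=.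
  apply/andP; split; last by apply/asboolP; exact: reach_refl.
  by apply/negP => /asboolP.
have [u tu bu] := IH t (leq_trans Nlt Ns).
by exists u => //; exact: reach_trans st tu.
Qed.

(** * Null events and the qualitative meaning of always and eventually *)

Lemma measurable_always X :
  measurable ([set pi | forall i, X (pi i)] : set (run_space M)).
Proof.
rewrite (_ : [set pi | _] = \bigcap_i [set pi : run_space M | X (pi i)]).
  by apply: bigcapT_measurable => i; exact: measurable_run_state.
by apply/seteqP; split => pi h i => [_|]; exact: h.
Qed.

Lemma setC_eventually X :
  ~` [set pi : run_space M | exists i, X (pi i)] =
  [set pi | forall i, (~` X) (pi i)].
Proof. by apply/seteqP; split => pi; rewrite /= -forallNE. Qed.

Lemma measurable_eventually X :
  measurable ([set pi | exists i, X (pi i)] : set (run_space M)).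
Proof.
rewrite -[X in measurable X]setCK setC_eventually; apply: measurableC.
exact: measurable_always.
Qed.

Lemma cylinder_last w i (pi : run M) :
  cylinder w pi -> size w = i.+1 -> pi i = last (init M) w.
Proof.
rewrite /cylinder /= => <-; rewrite size_mkseq => ->.
by rewrite mkseqS last_rcons.
Qed.

Lemma run_measure_start s : run_measure s (~` cylinder [:: s]) = 0%E.
Proof.
rewrite probability_setC; last exact: measurable_cylinder.
by rewrite run_measureP /= subee.
Qed.

Lemma run_measure_unreachable s w : w <> [::] -> ~ reach s (last s w) ->
  run_measure s (cylinder w) = 0%E.
Proof.
case: w => // t w _ nr; have [ts|ts] := eqVneq t s.
  move: nr; rewrite ts /= run_measureP => nr; congr (_%:E).
  apply/eqP; rewrite eq_le path_prob_ge0 andbT leNgt; apply/negP => w0.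
  by apply: nr; exists w.
apply/eqP; rewrite -measure_le0 -(run_measure_start s).
apply: le_measure; rewrite ?inE.
- exact: measurable_cylinder.
- by apply: measurableC; exact: measurable_cylinder.
- by move=> pi [e _] [e']; move: ts; rewrite -e -e' eqxx.
Qed.

(** A run that meets [X] has a finite prefix ending in a state unreachable from [s]. Words are
    countably many even in an infinite chain, and each such cylinder is null, so countably many null
    sets cover the event. *)
Lemma prob_eventually_unreachable s X : (forall t, reach s t -> ~ X t) ->
  run_measure s [set pi | exists i, X (pi i)] = 0%E.
Proof.
move=> nX; pose C n : set (run_space M) :=
  if @choice.unpickle (seq (state M)) n is Some w then
    if `[< w <> [::] /\ ~ reach s (last s w) >] then cylinder w else set0
  else set0.
apply: measure_negligible; first exact: measurable_eventually.
apply: (@negligibleS _ _ _ _ (\bigcup_n C n)).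
  move=> pi [i Xi]; exists (choice.pickle (mkseq pi i.+1)) => //.
  rewrite /C choice.pickleK asboolT.
    exact: (congr1 (mkseq pi) (size_mkseq pi i.+1)).
  by rewrite mkseqS last_rcons; split=> [|/nX//]; case: mkseq.
apply: negligible_bigcup => n; rewrite /C.
case: choice.unpickle => [w|]; last exact: negligible_set0.
case: asboolP => [[w0 nr]|_]; last exact: negligible_set0.
by apply/negligibleP; [exact: measurable_cylinder|exact: run_measure_unreachable].
Qed.

Lemma prob_alwaysP s X :
  run_measure s [set pi | forall i, X (pi i)] = 1%E <->
  (forall t, reach s t -> X t).
Proof.
have mE : measurable ([set pi | exists i, (~` X) (pi i)] : set (run_space M)).
  exact: measurable_eventually.
have -> : [set pi | forall i, X (pi i)] =
    ~` [set pi : run_space M | exists i, (~` X) (pi i)].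
  by rewrite setC_eventually setCK.
rewrite probability_setC//; split => [h t [w w0 wt]|h].
  apply: contrapT => nXt; move: h.
  (* The cylinder of a path of positive probability to the offending [t] lies inside the event of
     leaving [X], whose probability is therefore positive. *)
  suff h : ((path_prob s w)%:E <= run_measure s [set pi | exists i, (~` X) (pi i)])%E.
    have fe : run_measure s [set pi | exists i, (~` X) (pi i)] \is a fin_num.
      exact: fin_num_measure.
    move: fe h => /fineK <-; rewrite lee_fin -EFinB => h [/eqP].
    rewrite -subr_eq0 addrAC subrr sub0r oppr_eq0 => /eqP e.
    by move: h; rewrite e leNgt w0.
  rewrite -run_measureP; apply: le_measure; rewrite ?inE//.
    exact: measurable_cylinder.
  move=> pi c; exists (size w); rewrite (cylinder_last c)//=.
  by rewrite wt.
by rewrite prob_eventually_unreachable ?sube0// => t /h Xt; exact.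
Qed.

Lemma prob_eventually_gt0 s X :
  (0 < run_measure s [set pi | exists i, X (pi i)])%E ->
  exists2 t, reach s t & X t.
Proof.
move=> h; apply: contrapT => H; move: h.
by rewrite prob_eventually_unreachable ?ltxx// => t st Xt; apply: H; exists t.
Qed.

(* When [r] enumerates the states, this is the probability that a run from [s]
   stays outside [X] at the times 0, ..., n. *)
Fixpoint avoid (r : seq (state M)) X n s : R :=
  if `[< X s >] then 0 else
  if n is n'.+1 then \sum_(t <- r) trans s t * avoid r X n' t else 1.

Lemma avoid_in r X n s : X s -> avoid r X n s = 0.
Proof. by move=> Xs; case: n => [|n] /=; rewrite asboolT. Qed.

Lemma avoid0 r X s : ~ X s -> avoid r X 0 s = 1.
Proof. by move=> Xs /=; rewrite asboolF. Qed.

Lemma avoidS r X n s : ~ X s ->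
  avoid r X n.+1 s = \sum_(t <- r) trans s t * avoid r X n t.
Proof. by move=> Xs /=; rewrite asboolF. Qed.

(** * Almost sure reachability in finite chains *)

Section FiniteChain.
Context (r : seq (state M)) (r_uniq : uniq r) (rT : forall s, s \in r).

Lemma sum_trans s : \sum_(t <- r) trans s t = 1.
Proof.
have rE : [set` r] = [set: state M] 
  by apply/seteqP; split => // t _; exact: rT.
have fr : finite_set [set: state M] by apply/finite_seqP; exists r.
have := trans_sum1 s; rewrite esum_fset//; last first.
  by move=> t _; rewrite lee_fin trans_ge0.
by rewrite -rE -fsbig_seq// sumEFin => -[].
Qed.

Lemma avoid_le1 X n s : avoid r X n s <= 1.
Proof.
elim: n s => [|n IH] s /=; case: asboolP => // _.
rewrite -(sum_trans s); apply: ler_sum => t _.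
by rewrite ler_piMr ?trans_ge0.
Qed.

Lemma avoid_mono X m n s : (m <= n)%N -> avoid r X n s <= avoid r X m s.
Proof.
elim: m n s => [|m IH] n s mn.
  have [Xs|Xs] := pselect (X s); first by rewrite !avoid_in.
  by rewrite (avoid0 r Xs) avoid_le1.
case: n mn => // n mn.
have [Xs|Xs] := pselect (X s); first by rewrite !avoid_in.
rewrite !avoidS//; apply: ler_sum => t _.
by apply: ler_wpM2l; [exact: trans_ge0|exact: IH].
Qed.

(** The first transition of the path has positive weight and, by induction, a factor below 1. The
    other summands are at most their transition probabilities, and these sum to 1. *)
Lemma avoid_lt1 X s w : 0 < path_prob s w -> X (last s w) ->
  avoid r X (size w) s < 1.
Proof.
elim: w s => [|t w IH] s; first by move=> _ Xs; rewrite avoid_in.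
move=> /= h Xl; have [Xs|Xs] := pselect (X s); first by rewrite asboolT.
rewrite asboolF//.
have st : 0 < trans s t.
  rewrite lt_neqAle trans_ge0 andbT; apply: contraTneq h => <-.
  by rewrite mul0r ltxx.
have tw : 0 < path_prob t w by rewrite -(pmulr_rgt0 _ st).
rewrite -(sum_trans s) !(bigD1_seq t)//=; apply: ltr_leD.
  by rewrite gtr_pMr ?IH.
by apply: ler_sum => u _; rewrite ler_piMr ?trans_ge0 ?avoid_le1.
Qed.

(* The times 0, ..., m + n are split at time m, which both factors share. *)
Lemma avoid_le_mul X s m n c : 0 <= c ->
  (forall t, reach s t -> avoid r X n t <= c) ->
  avoid r X (m + n) s <= c * avoid r X m s.
Proof.
move=> c0; elim: m s => [|m IH] s h;
  (have [Xs|Xs] := pselect (X s); first by rewrite !avoid_in ?mulr0).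
  by rewrite add0n avoid0// mulr1; apply: h; exact: reach_refl.
rewrite addSn !avoidS// mulr_sumr; apply: ler_sum => t _.
rewrite mulrCA; have [st|st] := ltP 0 (trans s t).
  apply: ler_wpM2l; first exact: ltW.
  by apply: IH => u tu; apply: h; apply: reach_trans tu; exact: reach_step.
have -> : trans s t = 0 by apply/eqP; rewrite eq_le st trans_ge0.
by rewrite !mul0r.
Qed.

Lemma avoid_uniform X s :
  (forall t, reach s t -> exists2 u, reach t u & X u) ->
  exists N (c : R), [/\ 0 <= c, c < 1 & forall t, reach s t -> avoid r X N t <= c].
Proof.
move=> h.
(* The uniform pair is built along a list of states: [maxn] and [Num.max] merge the bounds, since
   avoidance only decreases with time. The list [r] then covers every state. *)
suff /(_ r)[N [c [c0 c1 H]]] : forall r' : seq (state M),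
    exists N (c : R), [/\ 0 <= c, c < 1 &
    forall t, t \in r' -> reach s t -> avoid r X N t <= c].
  by exists N, c; split => // t; exact: H.
elim=> [|t r' [N [c [c0 c1 IH]]]].
  by exists 0%N, 0; split.
have [st|nst] := pselect (reach s t); last first.
  exists N, c; split => // u; rewrite inE => /predU1P[->//|]; exact: IH.
have [_ [w w0 <-] Xw] := h t st.
exists (maxn N (size w)), (Num.max c (avoid r X (size w) t)); split.
- by rewrite le_max c0.
- by rewrite gt_max c1 avoid_lt1.
- move=> u; rewrite inE le_max => /predU1P[-> _|ur su].
    by rewrite (avoid_mono _ _ (leq_maxr _ _)) orbT.
  by rewrite (le_trans (avoid_mono _ _ (leq_maxl _ _)))// IH.
Qed.

Lemma avoid_small X s (e : R) :
  (forall t, reach s t -> exists2 u, reach t u & X u) -> 0 < e ->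
  exists n, avoid r X n s < e.
Proof.
move=> h e0; have [N [c [c0 c1 H]]] := avoid_uniform h.
have pow k t : reach s t -> avoid r X (k * N) t <= c ^+ k.
  elim: k => [|k IH] st; first by rewrite expr0 avoid_le1.
  rewrite mulSn addnC exprS (le_trans (avoid_le_mul _ c0 _))//.
    by move=> u tu; apply: H; exact: reach_trans tu.
  by apply: ler_wpM2l => //; exact: IH.
have /cvgrPdist_lt/(_ _ e0)[k _ /(_ k (leqnn k))] :
    (fun n => c ^+ n) @ \oo --> (0 : R).
  by apply: cvg_expr; rewrite ger0_norm.
rewrite /= sub0r normrN ger0_norm ?exprn_ge0// => ce.
by exists (k * N)%N; apply: le_lt_trans ce; apply: pow; exact: reach_refl.
Qed.

Lemma measure_le_sum s (A : set (run_space M)) (B : state M -> set (run_space M))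
    (r' : seq (state M)) :
  measurable A -> (forall t, measurable (B t)) ->
  (forall pi, A pi -> exists2 t, t \in r' & B t pi) ->
  (run_measure s A <= \sum_(t <- r') run_measure s (B t))%E.
Proof.
move=> mA mB; elim: r' A mA => [|t r' IH] A mA h.
  rewrite big_nil (_ : A = set0) ?measure0//.
  by apply/seteqP; split => // pi /h[].
rewrite big_cons.
have mD : measurable (A `\` B t) by exact: measurableD.
apply: (@le_trans _ _ (run_measure s (B t) + run_measure s (A `\` B t))%E).
  rewrite -measureU//; last by rewrite setDE setICA setICr setI0.
  apply: le_measure; rewrite ?inE//; first exact: measurableU.
  by move=> pi Ap; have [Bp|Bp] := pselect (B t pi); [left|right].
apply: leeD => //; apply: IH => // pi [/h[u]]; rewrite inE => /predU1P[->//|ur Bu _].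
by exists u.
Qed.

Lemma measurable_avoid X k n :
  measurable ([set pi | forall i, (i <= n)%N -> ~ X (pi (k + i)%N)]
    : set (run_space M)).
Proof.
rewrite (_ : [set pi | _] =
  \bigcap_i [set pi : run_space M | (i <= n)%N -> ~ X (pi (k + i)%N)]).
  apply: bigcapT_measurable => i.
  by apply: (@measurable_run_state _ _ M _ [set t | (i <= n)%N -> ~ X t]).
by apply/seteqP; split => pi h i => [_|]; exact: h.
Qed.

(** Induction on [n] for an arbitrary prefix [w]: the cylinder of [s :: w] is covered by those of
    its one-step extensions, which match the recursion of [avoid]. The general prefix replaces a
    Markov property for shifted runs. *)
Lemma prob_avoid X s w n :
  (run_measure s (cylinder (s :: w) `&`
     [set pi | forall i, (i <= n)%N -> ~ X (pi (size w + i)%N)])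
   <= (path_prob s w * avoid r X n (last s w))%:E)%E.
Proof.
elim: n w => [|n IH] w;
  have [Xs|Xs] := pselect (X (last s w)).
- rewrite avoid_in// mulr0 (_ : _ `&` _ = set0) ?measure0//.
  apply/seteqP; split => // pi [c] /(_ 0%N (leq0n _)).
  by rewrite addn0 (cylinder_last c).
- rewrite avoid0// mulr1 -run_measureP; apply: le_measure; rewrite ?inE//.
  + by apply: measurableI; [exact: measurable_cylinder|exact: measurable_avoid].
  + exact: measurable_cylinder.
- rewrite avoid_in// mulr0 (_ : _ `&` _ = set0) ?measure0//.
  apply/seteqP; split => // pi [c] /(_ 0%N (leq0n _)).
  by rewrite addn0 (cylinder_last c).
- rewrite avoidS// mulr_sumr -sumEFin.
  apply: (@le_trans _ _ (\sum_(t <- r) run_measure s (cylinder (s :: rcons w t) `&`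
     [set pi | forall i, (i <= n)%N -> ~ X (pi (size (rcons w t) + i)%N)]))%E).
    apply: measure_le_sum.
    + by apply: measurableI; [exact: measurable_cylinder|exact: measurable_avoid].
    + move=> t; apply: measurableI; first exact: measurable_cylinder.
      exact: measurable_avoid.
    (* The last state of [s :: w] is visited at time [size w], so the extending letter is the state
       at time [(size w).+1]. *)
    + move=> pi [c h]; exists (pi (size w).+1) => //; split.
        have e : mkseq pi (size w).+1 = s :: w := c.
        by rewrite -rcons_cons /cylinder; red; rewrite size_rcons mkseqS e.
      by move=> i i_n; rewrite size_rcons addSnnS; exact: h.
  apply: lee_sum => t _; apply: (le_trans (IH _)).
  by rewrite last_rcons -cats1 path_prob_cat /= mulr1 mulrA.
Qed.

Lemma prob_eventually1_seq X s :
  (forall t, reach s t -> exists2 u, reach t u & X u) ->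
  run_measure s [set pi | exists i, X (pi i)] = 1%E.
Proof.
move=> h; have mE := measurable_eventually X.
have mA := measurable_always (~` X).
rewrite -[X in run_measure s X]setCK setC_eventually probability_setC//.
(* A run that never meets [X] either starts in [s] and avoids [X] up to time [n], with probability
   at most [avoid r X n s], or starts elsewhere, which is a null event. For suitable [n] this is at
   most any given [e]. *)
suff -> : run_measure s [set pi | forall i, (~` X) (pi i)] = 0%E by rewrite sube0.
apply/eqP; rewrite -measure_le0; apply/lee_addgt0Pr => e e0; rewrite add0e.
have [n /ltW an] := avoid_small h e0.
have mS := @measurable_cylinder _ _ M [:: s].
have mI : measurable ((cylinder [:: s] : set (run_space M)) `&`
    [set pi : run_space M |
      forall i, (i <= n)%N -> ~ X (pi (size (Nil (state M)) + i)%N)]).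
  by apply: measurableI => //; exact: measurable_avoid.
have mSC := measurableC mS.
apply: (@le_trans _ _ (run_measure s (cylinder [:: s] `&`
     [set pi | forall i, (i <= n)%N -> ~ X (pi (size (Nil (state M)) + i)%N)]) +
   run_measure s (~` cylinder [:: s]))%E).
  rewrite -measureU//; last by rewrite setIAC setICr set0I.
  apply: le_measure; rewrite ?inE//; first exact: measurableU.
  move=> pi Ap; have [Bp|Bp] := pselect (cylinder [:: s] pi); [left|by right].
  by split => // i _; exact: Ap.
rewrite run_measure_start adde0 (le_trans (prob_avoid X s [::] n))//.
by rewrite lee_fin mul1r.
Qed.

End FiniteChain.

Lemma prob_eventually1 X s : finite_set [set: state M] ->
  (forall t, reach s t -> exists2 u, reach t u & X u) ->
  run_measure s [set pi | exists i, X (pi i)] = 1%E.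
Proof.
move=> /finite_seqP[r rE]; apply: (@prob_eventually1_seq (undup r)).
  exact: undup_uniq.
by move=> t; rewrite mem_undup; have : [set: state M] t by []; rewrite rE.
Qed.

End Reachability.

(** * Conjunctions of literals and the meaning of bounds *)

Section Normalization.
Local Open Scope classical_set_scope.
Local Open Scope ring_scope.
Context {R : realType} {AP : finType}.
Implicit Types (f g : formula AP) (A B C : {set literal AP}).

Lemma sat_big (M : markov_chain R AP) (s : state M) (I : eqType) (r : seq I)
    (P : pred I) (F : I -> formula AP) :
  sat s (\big[@FAnd AP/FTrue]_(i <- r | P i) F i) <->
  (forall i, i \in r -> P i -> sat s (F i)).
Proof.
elim: r => [|i r IH]; first by rewrite big_nil.
rewrite big_cons; have ir : i \in i :: r by rewrite inE eqxx.
have rS j : j \in r -> j \in i :: r by rewrite inE orbC => ->.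
case: ifPn => Pi /=; rewrite IH; split => [|h].
- by move=> [si h] j; rewrite inE => /predU1P[->//|]; exact: h.
- by split=> [|j /rS]; exact: h.
- by move=> h j; rewrite inE => /predU1P[->|]; [rewrite (negbTE Pi)|exact: h].
- by move=> j /rS; exact: h.
Qed.

Lemma sat_conj_lits (M : markov_chain R AP) (s : state M) A :
  sat s (conj_lits A) <-> (forall l, l \in A -> (l.1 \in label s) = l.2).
Proof.
rewrite /conj_lits sat_big; split=> h l; last by move=> _; exact: h.
by apply: h; rewrite mem_index_enum.
Qed.

Lemma sat_conj_litsU (M : markov_chain R AP) (s : state M) A B :
  sat s (conj_lits (A :|: B)) <-> sat s (conj_lits A) /\ sat s (conj_lits B).
Proof.
rewrite !sat_conj_lits; split=> [h|[hA hB] l].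
  by split=> l lA; apply: h; rewrite inE lA ?orbT.
by rewrite inE => /orP[/hA|/hB].
Qed.

Lemma sat_conj_lits0 (M : markov_chain R AP) (s : state M) :
  sat s (conj_lits finset.set0).
Proof. by apply/sat_conj_lits => l; rewrite inE. Qed.

Lemma sat_conj_lits1 (M : markov_chain R AP) (s : state M) l :
  sat s (conj_lits [set l]%SET) <-> sat s (FLit l).
Proof.
rewrite sat_conj_lits; split=> [h|h k]; first by apply: h; rewrite inE.
by rewrite inE => /eqP ->.
Qed.

Lemma conj_lits_all_unsat (M : markov_chain R AP) (s : state M) :
  AP -> ~ sat s (conj_lits finset.setT).
Proof.
move=> a /sat_conj_lits h.
have := h (a, true); have := h (a, false); rewrite !inE /= => -> //.
by move/(_ isT).
Qed.

(** The grammar has no constant for truth, so every body contains a literal and hence an atom.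
    Without an atom no conjunction of literals could express falsity. *)
Lemma body_inhabited f : G1FqG1_body f -> inhabited AP.
Proof. by elim=> // -[a b]; exists. Qed.

(** Every probability meets this bound. A bound that is neither this one nor [> 1] demands positive
    probability and is met by probability one; for reaching a formula inside a bottom component of a
    finite chain, the two coincide. *)
Definition trivial_bound (b : bound) (q : threshold) :=
  if b is Geq then val q == 0 else false.

Definition absurd_bound (b : bound) (q : threshold) :=
  if b is Gt then val q == 1 else false.

Section Semantics.
Context (M : markov_chain R AP).
Implicit Types s t u : state M.

Lemma sat_FAnd s f g : sat s (FAnd f g) <-> sat s f /\ sat s g.
Proof. by []. Qed.

Lemma sat_G1 s f : sat s (G1 f) <-> (forall t, reach s t -> sat t f).
Proof.
rewrite -(prob_alwaysP s [set t | sat t f]) /= rmorph1; split=> [h|->//].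
by apply/eqP; rewrite eq_le h andbT probability_le1//; exact: measurable_forall_sat.
Qed.

Lemma sat_F_trivial b q s f : trivial_bound b q -> sat s (FEv b q f).
Proof. by case: b => //= /eqP ->; rewrite rmorph0 measure_ge0. Qed.

Lemma sat_F_absurd b q s f : absurd_bound b q -> ~ sat s (FEv b q f).
Proof.
case: b => //= /eqP ->; rewrite rmorph1 => /lt_geF.
by rewrite probability_le1//; exact: measurable_exists_sat.
Qed.

Lemma sat_F_reach b q s f : ~~ trivial_bound b q -> sat s (FEv b q f) ->
  exists2 t, reach s t & sat t f.
Proof.
move=> nt h; apply: (@prob_eventually_gt0 _ _ _ s [set t | sat t f]).
have /andP[q0 _] := svalP q.
have q0' : (0 <= (ratr (val q) : R)%:E)%E by rewrite lee_fin ler0q.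
case: b nt h => /= nt h; last exact: le_lt_trans h.
by apply: lt_le_trans h; rewrite lte_fin ltr0q lt_neqAle eq_sym nt.
Qed.

Lemma sat_F1_reach s f : sat s (F1 f) -> exists2 t, reach s t & sat t f.
Proof. exact: sat_F_reach. Qed.

Context (finM : finite_set [set: state M]).

Lemma sat_F_inevitable b q s f : ~~ absurd_bound b q ->
  (forall t, reach s t -> exists2 u, reach t u & sat u f) -> sat s (FEv b q f).
Proof.
move=> na h; rewrite /= (@prob_eventually1 _ _ _ [set t | sat t f])//.
have /andP[_ q1] := svalP q.
have r1 : (1 : R) = ratr 1 by rewrite rmorph1.
case: b na => /= na; first by rewrite lee_fin r1 ler_rat.
by rewrite lte_fin r1 ltr_rat lt_neqAle na.
Qed.

End Semantics.

(** * Normal forms of bodies *)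

Definition class_cond (M : markov_chain R AP) (s : state M) B
    (Cs : seq {set literal AP}) :=
  (forall t, reach s t -> sat t (conj_lits B)) /\
  (forall C, C \in Cs -> exists2 t, reach s t & sat t (conj_lits C)).

(** Both clauses of [class_cond] depend only on the set of reachable states, which is the same for
    all states of a bottom component. *)
Lemma class_cond_reach (M : markov_chain R AP) (s t : state M) B Cs :
  bottom s -> reach s t -> class_cond t B Cs -> class_cond s B Cs.
Proof.
move=> bs st [hB hC]; have ts := bs _ st; split.
  by move=> u su; apply: hB; exact: reach_trans su.
by move=> C /hC[u tu uC]; exists u => //; exact: reach_trans tu.
Qed.

Lemma class_cond_cat (M : markov_chain R AP) (s : state M) B B' Cs Cs' :
  class_cond s (B :|: B') (Cs ++ Cs') <-> class_cond s B Cs /\ class_cond s B' Cs'.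
Proof.
split=> [[hB hC]|[[hB hC] [hB' hC']]].
  split; split.
  - by move=> t /hB/sat_conj_litsU[].
  - by move=> C CC; apply: hC; rewrite mem_cat CC.
  - by move=> t /hB/sat_conj_litsU[].
  - by move=> C CC; apply: hC; rewrite mem_cat CC orbT.
split=> [t st|C]; first by apply/sat_conj_litsU; split; [exact: hB|exact: hB'].
by rewrite mem_cat => /orP[/hC|/hC'].
Qed.

Lemma class_cond_nil (M : markov_chain R AP) (s : state M) :
  class_cond s finset.set0 [::].
Proof. by split=> // t _; exact: sat_conj_lits0. Qed.

(** The triple is chosen before the chain. [L] constrains the current state only, while [B] and [Cs]
    speak of the whole component. This separation lets each operator act simply: [F] turns [L] into
    one more member of [Cs], and [G] moves it into [B]. *)
Lemma bottom_normal_form f : G1FqG1_body f ->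
  exists L B Cs, forall (M : markov_chain R AP), finite_set [set: state M] ->
    forall s : state M, bottom s ->
      (sat s f <-> sat s (conj_lits L) /\ class_cond s B Cs).
Proof.
elim=> {f} [l|f g _ [L [B [Cs IHf]]] _ [L' [B' [Cs' IHg]]]
  |b q f bf [L [B [Cs IH]]]|f _ [L [B [Cs IH]]]].
- exists [set l]%SET, finset.set0, [::] => M finM s bs.
  rewrite sat_conj_lits1; split=> [h|[]//]; split=> //; exact: class_cond_nil.
- exists (L :|: L'), (B :|: B'), (Cs ++ Cs') => M finM s bs.
  rewrite sat_conj_litsU class_cond_cat /= IHf// IHg//; tauto.
- have [tr|nt] := boolP (trivial_bound b q).
    exists finset.set0, finset.set0, [::] => M finM s bs.
    split=> _; last exact: sat_F_trivial.
    by split; [exact: sat_conj_lits0|exact: class_cond_nil].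
  have [ab|na] := boolP (absurd_bound b q).
    have [a] := body_inhabited bf.
    (* The conjunction of all literals is false, as there is an atom. *)
    exists finset.set0, finset.set0, [:: finset.setT] => M finM s bs.
    split=> [/(sat_F_absurd ab)//|[_ [_ /(_ finset.setT)]]].
    by rewrite inE eqxx => /(_ isT)[t _ /conj_lits_all_unsat]; case.
  (* The whole component shares [B] and [Cs], so only [L] needs a witness state. Conversely, that
     witness is reachable from everywhere in the component, hence is reached almost surely. *)
  exists finset.set0, B, (L :: Cs) => M finM s bs; split.
    move=> /(sat_F_reach nt)[t st]; have bt := reach_bottom bs st.
    move=> /(IH M finM t bt)[tL ht]; split; first exact: sat_conj_lits0.
    have [hB hC] := class_cond_reach bs st ht.
    by split=> // C; rewrite inE => /predU1P[->|/hC//]; exists t.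
  move=> [_ [hB hC]]; have [|t st tL] := hC L; first by rewrite inE eqxx.
  have ts := bs _ st; have bt := reach_bottom bs st.
  apply: sat_F_inevitable => // u su; exists t.
    by apply: reach_trans st; exact: bs.
  apply/(IH M finM t bt); split=> //; apply: (class_cond_reach bt ts).
  by split=> // C CC; apply: hC; rewrite inE CC orbT.
- exists finset.set0, (L :|: B), Cs => M finM s bs; rewrite sat_G1; split.
    move=> h; split; first exact: sat_conj_lits0.
    have /(IH M finM s bs)[_ [_ hC]] := h s (reach_refl s).
    split=> // t st; apply/sat_conj_litsU.
    have /(IH M finM t (reach_bottom bs st))[tL [tB _]] := h t st.
    by split=> //; apply: tB; exact: reach_refl.
  move=> [_ [hB hC]] t st; have bt := reach_bottom bs st.
  apply/(IH M finM t bt); have /sat_conj_litsU[tL _] := hB t st.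
  split=> //; apply: (class_cond_reach bt (bs _ st)).
  by split=> // u /hB/sat_conj_litsU[].
Qed.

(** [A] collects the literals under no [F]. For [F] the empty set suffices: every reachable state
    leads to a bottom state, where the formula is assumed, so its argument stays reachable. For [G]
    the set is unchanged, since demanding [G1 f] at all reachable states is demanding [f] there. *)
Lemma global_normal_form f : G1FqG1_body f ->
  exists A, forall (M : markov_chain R AP), finite_set [set: state M] ->
    forall s : state M,
      (forall t, reach s t -> sat t f) <->
      (forall t, reach s t -> sat t (conj_lits A)) /\
      (forall t, reach s t -> bottom t -> sat t f).
Proof.
elim=> {f} [l|f g _ [A IHf] _ [A' IHg]|b q f _ _|f _ [A IH]].
- exists [set l]%SET => M finM s; split=> [h|[h _] t st]; last first.
    by apply/sat_conj_lits1; exact: h.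
  by split=> t st; [apply/sat_conj_lits1; exact: h|move=> _; exact: h].
- exists (A :|: A') => M finM s; split=> [h|[hA hb] t st].
    split=> t st; last by move=> _; exact: h.
    have /(IHf M finM)[fA _] : forall u, reach s u -> sat u f by move=> u /h[].
    have /(IHg M finM)[gA _] : forall u, reach s u -> sat u g by move=> u /h[].
    by apply/sat_conj_litsU; split; [exact: fA|exact: gA].
  split; move: t st; [apply/(IHf M finM)|apply/(IHg M finM)];
    by split=> t st; [have /sat_conj_litsU[] := hA t st|case/(hb t st)].
- exists finset.set0 => M finM s; split=> [h|[_ hb] t st].
    by split=> t st; [exact: sat_conj_lits0|move=> _; exact: h].
  have [tr|nt] := boolP (trivial_bound b q); first exact: sat_F_trivial.
  have reach_f u : reach t u -> exists2 v, reach u v & sat v (FEv b q f).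
    move=> tu; have [v uv bv] := bottom_exists u finM; exists v => //.
    by apply: hb => //; apply: reach_trans uv; exact: reach_trans tu.
  (* An unsatisfiable bound would have to hold at a bottom state, and one is always reachable. *)
  have [ab|na] := boolP (absurd_bound b q).
    by have [v _ /(sat_F_absurd ab)] := reach_f t (reach_refl t).
  apply: sat_F_inevitable => // u /reach_f[v uv /(sat_F_reach nt)[x vx xf]].
  by exists x => //; exact: reach_trans vx.
- exists A => M finM s; split=> [h|[hA hb] t st].
    have /(IH M finM)[fA _] : forall u, reach s u -> sat u f.
      by move=> u /h/sat_G1; apply; exact: reach_refl.
    by split=> // t st _; exact: h.
  apply/sat_G1 => u /(reach_trans st) su; move: u su; apply/(IH M finM).
  by split=> // u su bu; have /sat_G1 := hb u su bu; apply; exact: reach_refl.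
Qed.

End Normalization.

Theorem theorem3 (R : realType) (AP : finType) (phi : formula AP)
    (hphi : G1FqG1_formula phi) :
  exists (I : {fset nat}) (A B : {set literal AP})
         (C : nat -> {set literal AP}),
    fin_equiv R (G1 phi)
      (G1 (FAnd (conj_lits A)
          (FAnd (F1 (G1 (conj_lits B)))
                (\big[@FAnd AP/FTrue]_(i <- I) F1 (conj_lits (C i)))))).
Proof.
case: hphi => f bf ->.
have [L [B [Cs bot]]] := bottom_normal_form (R := R) bf.
have [A glob] := global_normal_form (R := R) bf.
(* The indices are the positions in [Cs]. [L] joins [B] because [f] has to hold at every reachable
   bottom state, hence throughout each reachable bottom component. *)
exists [fset i in iota 0 (size Cs)]%fset, A, (L :|: B)%SET, (nth finset.set0 Cs).
move=> M finM; rewrite /models sat_G1.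
have GG : (forall t, reach (init M) t -> sat t (G1 f)) <->
          (forall t, reach (init M) t -> sat t f).
  split=> h t st; first by have /sat_G1 := h t st; apply; exact: reach_refl.
  by apply/sat_G1 => u tu; apply: h; exact: reach_trans tu.
rewrite GG glob// sat_G1; split=> [[hA hb] t st|h].
  (* From every reachable state one can enter a bottom component where [L :|: B] holds everywhere
     and each member of [Cs] occurs, so the targets of all [F1] conjuncts stay reachable. *)
  have reach_class u : reach t u -> exists2 v, reach u v &
      bottom v /\ class_cond v (L :|: B)%SET Cs.
    move=> tu; have [v uv bv] := bottom_exists u finM; exists v => //; split=> //.
    have sv : reach (init M) v by apply: reach_trans uv; exact: reach_trans tu.
    have /(bot M finM v bv)[_ [_ hC]] := hb v sv bv.
    split=> // x vx; apply/sat_conj_litsU; have bx := reach_bottom bv vx.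
    have /(bot M finM x bx)[xL [xB _]] := hb x (reach_trans sv vx) bx.
    by split=> //; apply: xB; exact: reach_refl.
  split; first exact: hA.
  split.
    apply: sat_F_inevitable => // u /reach_class[v uv [_ [vB _]]].
    by exists v => //; apply/sat_G1.
  apply/sat_big => i; rewrite !inE mem_iota add0n => iC _.
  apply: sat_F_inevitable => // u /reach_class[v uv [_ [_ hC]]].
  have [x vx xC] := hC _ (mem_nth finset.set0 iC).
  by exists x => //; exact: reach_trans vx.
split=> t st; first by have [] := h t st.
move=> bt; have /sat_FAnd[_ /sat_FAnd[hF /sat_big hC]] := h t st.
(* Since [t] is bottom, the state [u] can return to [t], so what holds everywhere from [u] holds
   everywhere from [t]. *)
have [u tu /sat_G1 uB] := sat_F1_reach hF.
have tB x : reach t x -> sat x (conj_lits (L :|: B)%SET).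
  by move=> tx; apply: uB; apply: reach_trans tx; exact: bt.
apply/(bot M finM t bt); split.
  by have /sat_conj_litsU[] := tB t (reach_refl t).
split=> [x /tB/sat_conj_litsU[]//|C CC].
have := hC (index C Cs); rewrite !inE mem_iota index_mem CC nth_index//.
by move=> /(_ isT isT)/sat_F1_reach.
Qed.
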